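(* Let $k$ be a field (of any characteristic), let $\Delta$ be an oriented pseudo-manifold over $k$ of dimension $n-1$ with vertices $v_1,\ldots,v_N$ and maximal simplices $\sigma_1,\ldots,\sigma_M$, and let $K=k(a_{i,j})_{1\le i\le n,\,0\le j\le N}$. Let $\Pi_i$ be the boundary of the cone $\{v_0\}*\sigma_i$ over $\sigma_i$ with new vertex $v_0$, and let $W_\Delta$, $W_{\Pi_i}$, $c_{\Pi_i}$, $\operatorname{ev}_{\Pi_i}$ be as defined in the context. Then, as linear functions on $K[x_1,\ldots,x_N]_n$, \[ W_\Delta=\sum_{i=1}^MW_{\Pi_i}=\sum_{i=1}^M\frac{1}{c_{\Pi_i}}\operatorname{ev}_{\Pi_i}. \]
   Context: Pseudo-manifolds. A pseudo-manifold of dimension $n-1$ is a (finite, abstract) pure simplicial complex $\Delta$ of dimension $n-1$ such that every $(n-2)$-simplex lies in exactly two $(n-1)$-simplices and the geometric realization of $\Delta$ remains connected after removing its $(n-3)$-skeleton. An orientation of a simplex is an ordering of its vertices up to even permutations; the orientation $v_{j_1},\ldots,v_{j_n}$ induces the orientation $v_{j_2},\ldots,v_{j_n}$ on its facet. An orientation of $\Delta$ is a choice of orientation of each $(n-1)$-simplex such that for every $(n-2)$-simplex the orientations induced from the two $(n-1)$-simplices containing it are opposite. Over a field of characteristic $2$ every pseudo-manifold counts as oriented, with an arbitrary ordering of the vertices of each maximal simplex. Mixed volume. Let $\Delta$ be an oriented pseudo-manifold of dimension $n-1$. For a maximal simplex $\sigma$ with positively ordered vertices $v_{j_1},\ldots,v_{j_n}$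 put $\det\sigma=\det(a_{p,j_q})_{1\le p,q\le n}$. Let $\phi_\sigma:K[t_1,\ldots,t_n]\to K[x_{j_1},\ldots,x_{j_n}]$ be the isomorphism $t_p\mapsto\sum_{q}a_{p,j_q}x_{j_q}$. For a polynomial $f$ in the variables $x_j$ let $f_\sigma\in K[t_1,\ldots,t_n]$ be obtained by setting $x_j=0$ for all $v_j\notin\sigma$ and applying $\phi_\sigma^{-1}$; let $\chi_\sigma=(\det\sigma)\,\phi_\sigma^{-1}(x_{j_1}\cdots x_{j_n})$. For $f$ homogeneous of degree $n$ the sum $W_\Delta(f)=\sum_\sigma f_\sigma/\chi_\sigma$ over all maximal simplices $\sigma$ is an element of $K$; this defines the linear function (mixed volume) $W_\Delta:K[x_1,\ldots,x_N]_n\to K$. The subscript $n$ denotes the homogeneous part of degree $n$. The spheres $\Pi_i$. Let $v_0$ be a new vertex, with associated variables $x_0$ and $a_{1,0},\ldots,a_{n,0}$. For a maximal simplex $\sigma_i$ of $\Delta$ with positively ordered vertices $v_{j_1},\ldots,v_{j_n}$, let $\Pi_i$ be the boundary of the $n$-simplex $\{v_0\}*\sigma_i$, a simplicial $(n-1)$-sphere, oriented so that $\sigma_i$ has the same orientation in $\Pi_i$ as in $\Delta$. The function $W_{\Pi_i}$ is the mixed volume of $\Pi_i$ (defined with the parameters $a_{p,0},a_{p,j_1},\ldots,a_{p,j_n}$), regarded as a function on $K[x_1,\ldots,x_N]_n$ by first setting $x_j=0$ for all $v_j\notin\Pi_i$. Let $A_i$ be the $n\times(n+1)$ matrix whose columns,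 numbered $0,1,\ldots,n$, are the columns $(a_{p,0})_p,(a_{p,j_1})_p,\ldots,(a_{p,j_n})_p$, and let $X_q^{(i)}$ be $(-1)^q$ times the determinant of $A_i$ with its $q$-th column removed. Set $c_{\Pi_i}=X_0^{(i)}X_1^{(i)}\cdots X_n^{(i)}\in K$, and let $\operatorname{ev}_{\Pi_i}:K[x_1,\ldots,x_N]\to K$ be the $K$-algebra homomorphism with $x_{j_q}\mapsto X_q^{(i)}$ for $q=1,\ldots,n$ and $x_j\mapsto0$ if $v_j\notin\Pi_i$. *)

(* Defs.v *)
From mathcomp Require Import all_boot all_order all_fingroup all_algebra.
From mathcomp Require Import fraction.
From mathcomp Require Import reals.
From mathcomp Require Import topology.
From mathcomp Require Import mpoly.
From Stdlib Require Import ClassicalEpsilon.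

Set Implicit Arguments.
Unset Strict Implicit.
Unset Printing Implicit Defensive.

Import GRing.Theory Num.Theory numFieldTopology.Exports.
Local Open Scope ring_scope.

(* A complex lives on the ground set 'I_m; not every element of 'I_m need be
   a vertex of it.  The empty simplex belongs to every complex. *)
Section Complexes.
Variable m : nat.
Implicit Types (D : {set {set 'I_m}}) (F G : {set 'I_m}).

Definition simplicial_complex D : Prop :=
  set0 \in D /\ forall F G, F \in D -> G \subset F -> G \in D.

Definition facets D : {set {set 'I_m}} := [set F | maxset (mem D) F].

Definition facets_of_card (n : nat) D : Prop :=
  forall F, F \in facets D -> #|F| = n.

Section Realization.
Variable R : realType.

(* Barycentric coordinates, with the subspace topology of R^m. *)
Definition realization D : 'rV[R]_m -> Prop := fun p =>
  [/\ forall j, 0 <= p 0 j, \sum_j p 0 j = 1 & [set j | p 0 j != 0] \in D].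

(* A simplex of dimension at most n - 3 has at most n - 2 vertices. *)
Definition skeleton_n_minus_3 (n : nat) D : {set {set 'I_m}} :=
  [set F in D | (#|F| + 2 <= n)%N].

Definition pseudo_manifold (n : nat) D : Prop :=
  [/\ simplicial_complex D,
      facets_of_card n D,
      (forall F, F \in D -> #|F|.+1 = n ->
         #|[set G in D | (#|G| == n) && (F \subset G)]| = 2)
    & connected.connected (fun p : 'rV[R]_m =>
        realization D p /\ ~ realization (skeleton_n_minus_3 n D) p)].

End Realization.

Section Orientations.
Variable n : nat.

Definition same_orientation (s t : n.-tuple 'I_m) : bool :=
  [exists g : 'S_n, ~~ odd_perm g && (t == [tuple tnth s (g i) | i < n])].

(* An orientation of a facet is given by one of its positive orderings. *)
Definition orders_facets D (o : {set 'I_m} -> n.-tuple 'I_m) : Prop :=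
  forall F, F \in facets D -> perm_eq (o F) (enum F).

(* u and u' order F and G so that both induce the same ordering
   behead u = behead u' of the common ridge; it has opposite induced
   orientations when exactly one of u, u' is positive.  Comparing signs on the
   facets rather than on the ridge also makes sense when the ridge is a single
   vertex, which has only one ordering. *)
Definition coherent D (o : {set 'I_m} -> n.-tuple 'I_m) : Prop :=
  forall F G, F \in facets D -> G \in facets D -> F != G ->
  forall u u' : n.-tuple 'I_m, perm_eq u (enum F) -> perm_eq u' (enum G) ->
    behead u = behead u' ->
    same_orientation (o F) u = ~~ same_orientation (o G) u'.

Definition oriented_over (k : fieldType) D
    (o : {set 'I_m} -> n.-tuple 'I_m) : Prop :=
  orders_facets D o /\ (2%N \notin [pchar k] -> coherent D o).

End Orientations.
End Complexes.

Section MixedVolume.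
Variables (K : fieldType) (n m : nat) (a : 'M[K]_(n, m)).
Implicit Types (s : n.-tuple 'I_m) (f : {mpoly K[m]}).

Definition simplex_mx s : 'M[K]_n := \matrix_(p, q) a p (tnth s q).

Definition simplex_det s : K := \det (simplex_mx s).

Definition phi s (g : {mpoly K[n]}) : {mpoly K[m]} :=
  g \mPo [tuple \sum_q a p (tnth s q) *: 'X_(tnth s q) | p < n].

Definition restrict s f : {mpoly K[m]} :=
  f \mPo [tuple (if j \in s then 'X_j else 0) | j < m].

(* Sets x_j to 0 for j \notin s and inverts phi; see phi_invK and phiK. *)
Definition phi_inv s f : {mpoly K[n]} :=
  f \mPo [tuple (if [pick q | tnth s q == j] is Some q
                 then \sum_p invmx (simplex_mx s) q p *: 'X_p else 0) | j < m].

Lemma comp_mpolyA_tuple (r r' r'' : nat) (f : {mpoly K[r]})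
    (u : r.-tuple {mpoly K[r']}) (v : r'.-tuple {mpoly K[r'']}) :
  (f \mPo u) \mPo v = f \mPo [tuple tnth u i \mPo v | i < r].
Proof.
rewrite !(comp_mpolyEX f) raddf_sum /=; apply: eq_bigr => e _.
rewrite comp_mpolyZ !comp_mpolyX rmorph_prod /=; congr (_ *: _).
by apply: eq_bigr => i _; rewrite rmorphXn /= tnth_mktuple.
Qed.

Lemma pick_tnth s q : uniq s -> [pick r | tnth s r == tnth s q] = Some q.
Proof.
move=> us; case: pickP => [r /eqP e|/(_ q)]; last by rewrite eqxx.
by move/tuple_uniqP: us => /(_ _ _ e) ->.
Qed.

Lemma phi_invK s g : uniq s -> simplex_det s != 0 -> phi_inv s (phi s g) = g.
Proof.
move=> us d0; rewrite /phi_inv /phi comp_mpolyA_tuple -[RHS]comp_mpoly_id.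
congr (_ \mPo _); apply: eq_from_tnth => p; rewrite !tnth_mktuple raddf_sum /=.
have u : simplex_mx s \in unitmx by rewrite unitmxE unitfE.
transitivity (\sum_r (1%:M : 'M[K]_n) p r *: ('X_r : {mpoly K[n]})); last first.
  rewrite (bigD1 p) //= mxE eqxx scale1r big1 ?addr0 // => r.
  by rewrite mxE eq_sym => /negbTE ->; rewrite scale0r.
rewrite -(mulmxV u); under [RHS]eq_bigr do rewrite mxE scaler_suml.
rewrite [RHS]exchange_big; apply: eq_bigr => q _.
rewrite comp_mpolyZ comp_mpolyXU -tnth_nth tnth_mktuple pick_tnth // scaler_sumr.
by apply: eq_bigr => r _; rewrite scalerA mxE.
Qed.

Lemma phiK s f :
  uniq s -> simplex_det s != 0 -> phi s (phi_inv s f) = restrict s f.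
Proof.
move=> us d0; rewrite /phi_inv /phi comp_mpolyA_tuple /restrict.
congr (_ \mPo _); apply: eq_from_tnth => j; rewrite !tnth_mktuple.
have u : simplex_mx s \in unitmx by rewrite unitmxE unitfE.
case: ifP => [/tnthP [q ->]|js]; last first.
  case: pickP => [q /eqP e|_]; last by rewrite raddf0.
  by rewrite -e mem_tnth in js.
rewrite pick_tnth // raddf_sum /=.
transitivity (\sum_r (1%:M : 'M[K]_n) q r *: ('X_(tnth s r) : {mpoly K[m]})).
  rewrite -(mulVmx u); under [RHS]eq_bigr do rewrite mxE scaler_suml.
  rewrite [RHS]exchange_big; apply: eq_bigr => p _.
  rewrite comp_mpolyZ comp_mpolyXU -tnth_nth tnth_mktuple scaler_sumr.
  by apply: eq_bigr => r _; rewrite scalerA mxE.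
rewrite (bigD1 q) //= mxE eqxx scale1r big1 ?addr0 // => r.
by rewrite mxE eq_sym => /negbTE ->; rewrite scale0r.
Qed.

Definition chi s : {mpoly K[n]} :=
  simplex_det s *: phi_inv s (\prod_q 'X_(tnth s q)).

Variables (D : {set {set 'I_m}}) (o : {set 'I_m} -> n.-tuple 'I_m).

Definition mixed_volume_sum f : {fraction {mpoly K[n]}} :=
  \sum_(F in facets D) tofrac (phi_inv (o F) f) / tofrac (chi (o F)).

(* The element of K equal to the above sum of rational functions in the t_p,
   unspecified if that sum is not constant. *)
Definition mixed_volume f : K :=
  epsilon (inhabits 0) (fun c : K => mixed_volume_sum f = tofrac c%:MP).

Lemma mixed_volumeP f c :
  mixed_volume_sum f = tofrac c%:MP -> mixed_volume f = c.
Proof.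
move=> fc; have /(epsilon_spec (inhabits 0)) : exists c : K,
  mixed_volume_sum f = tofrac c%:MP by exists c.
by rewrite -/(mixed_volume f) fc => /eqP; rewrite tofrac_eq mpolyC_eq => /eqP.
Qed.

End MixedVolume.

Section Params.
Variables (k : fieldType) (n N : nat).

Definition param_field : fieldType := {fraction {mpoly k[n * N.+1]}}.

(* Column 0 holds the parameters a_{p,0} of the new vertex, and column
   lift ord0 j those of the vertex j : 'I_N of the complex. *)
Definition param_mx : 'M[param_field]_(n, N.+1) :=
  \matrix_(p, j) tofrac ('X_(mxvec_index p j) : {mpoly k[n * N.+1]}).

End Params.

(* The new vertex is ord0 : 'I_N.+1; a vertex j : 'I_N becomes lift ord0 j. *)
Section ConeBoundary.
Variables (n N : nat).
Implicit Types (F : {set 'I_N}) (s : n.-tuple 'I_N).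

Definition old_vertices F : {set 'I_N.+1} := [set lift ord0 j | j in F].

Definition old_tuple s : n.-tuple 'I_N.+1 := map_tuple (lift ord0) s.

Definition cone_boundary F : {set {set 'I_N.+1}} :=
  [set G : {set 'I_N.+1} | G \proper (ord0 |: old_vertices F)].

Variables (K : fieldType) (a : 'M[K]_(n, N.+1)).

Definition mixed_volume_cone F (o : {set 'I_N.+1} -> n.-tuple 'I_N.+1)
    (f : {mpoly K[N]}) : K :=
  mixed_volume a (cone_boundary F) o
    (f \mPo [tuple (if j \in F then 'X_(lift ord0 j) else 0) | j < N]).

Definition cone_mx s : 'M[K]_(n, n.+1) :=
  \matrix_(p, q) a p (tnth [tuple of ord0 :: old_tuple s] q).

Definition cone_minor s (q : 'I_n.+1) : K :=
  (-1) ^+ q * \det (col' q (cone_mx s) : 'M[K]_n).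

Definition cone_const s : K := \prod_q cone_minor s q.

(* Column q.+1 of cone_mx s belongs to the q-th vertex of s, q counted
   from 0. *)
Definition cone_ev s (f : {mpoly K[N]}) : K :=
  f.@[fun j => if [pick q | tnth s q == j] is Some q
               then cone_minor s (lift ord0 q) else 0].

End ConeBoundary.

(* Main.v *)
From HB Require Import structures.
Require Import Defs.
From mathcomp Require Import all_boot all_order all_fingroup all_algebra.
From mathcomp Require Import fraction.
From mathcomp Require Import reals.
From mathcomp Require Import zify ring.
From mathcomp Require Import mpoly.

Set Implicit Arguments.
Unset Strict Implicit.
Unset Printing Implicit Defensive.

Import GRing.Theory.
Local Open Scope ring_scope.

(** Fix a maximal simplex sigma.  Since phi_sigma^(-1) sends each x_j with j in sigma
to a linear form in t_1, ..., t_n, forming f_sigma amounts to evaluating f at one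
point: the vector x supported on sigma with A x = t, where A is the matrix
of parameters and t = (t_1, ..., t_n).  Writing x^sigma for this point of
k(a)(t)^N, the term of sigma in the mixed volume is
f(x^sigma) / (det sigma * prod_(j in sigma) x^sigma_j).  It depends on the
ordering of sigma only through the sign of the determinant ([summandE]).

The first equality holds before summing to a constant, as an identity of
rational functions in t.  The boundary of the cone over sigma consists of sigma
itself, whose term is the one of the complex, and of the simplices v_0 * rho
with rho a ridge of sigma.  Every ridge rho lies in exactly two maximal
simplices, and the two orientations that v_0 * rho receives from them are
opposite, so these terms cancel in pairs ([cone_summand_opposite],
[sum_cone_boundaries]).

For the second equality, let X be the vector of signed maximal minors of the
n x (n+1) matrix of the cone, a generator of the kernel of that matrix.
Coherence of the orientation means that the determinant of the facet opposite
to vertex j is X_j ([minor_at_det]).  If y is any solution of A y = t, the point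
of the facet opposite to j is y - r_j X with r_j = y_j / X_j, its coordinates
are X_i (r_i - r_j), and the sum over the n+1 facets becomes
(1/c) sum_j g(r_j) / prod_(i <> j) (r_i - r_j) for g(l) = f(y - l X), with
c = prod_j X_j.  As g has degree at most n, Lagrange interpolation at the n+1
nodes r_j evaluates this sum to (-1)^n / c times the coefficient of l^n in g,
which is f(-X); by homogeneity the result is f(X) / c ([boundary_sum]).

No permutation sign of a ridge inside a facet is computed: coherence is used
only as a relation between products of determinants ([coherent_det]), which is
also valid in characteristic 2, where orientations carry no information. *)

(** * Leading coefficients and Lagrange interpolation *)

Section Lagrange.
Variable L : fieldType.

(** Bounding the degree and computing the coefficient at the bound together
lets products be treated without knowing that the bound is attained. *)
Lemma coef_mul_top (p q : {poly L}) d e :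
  (size p <= d.+1)%N -> (size q <= e.+1)%N ->
  (size (p * q)%R <= (d + e).+1)%N /\ (p * q)`_(d + e) = p`_d * q`_e.
Proof.
move=> sp sq; split.
  by have := size_polyMleq p q; lia.
have de : (d < (d + e).+1)%N by rewrite ltnS leq_addr.
rewrite coefM (bigD1 (Ordinal de)) //= addKn big1 ?addr0 // => i id.
case: (ltngtP i d) => [lt|gt|eq].
- rewrite [q`__]nth_default ?mulr0 //; apply: leq_trans sq _.
  by lia.
- by rewrite [p`_i]nth_default ?mul0r //; apply: leq_trans sp _.
- by case/eqP: id; apply: val_inj.
Qed.

Lemma coef_prod_top (I : Type) (r : seq I) (F : I -> {poly L}) (d : I -> nat) :
  (forall i, size (F i) <= (d i).+1)%N ->
  (size (\prod_(i <- r) F i)%R <= (\sum_(i <- r) d i).+1)%N /\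
  (\prod_(i <- r) F i)`_(\sum_(i <- r) d i) = \prod_(i <- r) (F i)`_(d i).
Proof.
move=> sF; elim: r => [|i r [sr cr]].
  by rewrite !big_nil coef1 size_poly1.
by rewrite !big_cons -cr; apply: coef_mul_top.
Qed.

Lemma coef_exp_top (p : {poly L}) e : (size p <= 2)%N ->
  (size (p ^+ e)%R <= e.+1)%N /\ (p ^+ e)`_e = p`_1 ^+ e.
Proof.
move=> sp; have := @coef_prod_top _ (index_iota 0 e) (fun=> p) (fun=> 1%N).
by rewrite sum_nat_const_nat !prodr_const_nat subn0 muln1; apply.
Qed.

(** Compare the coefficients of degree [n] in the interpolation formula, each
basis polynomial being a scalar multiple of a monic one of degree [n]. *)
Lemma lagrange_top_coef (I : finType) (P : {set I}) (n : nat) (r : I -> L)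
    (g : {poly L}) :
  #|P| = n.+1 -> {in P &, injective r} -> (size g <= n.+1)%N ->
  \sum_(j in P) g.[r j] / \prod_(i in P :\ j) (r j - r i) = g`_n.
Proof.
move=> cP rI sg.
pose b j : {poly L} := \prod_(i in P :\ j) ('X - (r i)%:P).
pose c j := g.[r j] / \prod_(i in P :\ j) (r j - r i).
have sb j : j \in P -> size (b j) = n.+1.
  move=> jP; rewrite /b -big_enum size_prod_XsubC -cardE.
  by rewrite cardsDS ?sub1set // cP cards1 subn1.
suff gE : g = \sum_(j in P) c j *: b j.
  rewrite [in RHS]gE coef_sum; apply: eq_bigr => j jP; rewrite coefZ.
  have : b j \is monic by apply: monic_prod => i _; apply: monicXsubC.
  by move/monicP; rewrite lead_coefE sb //= => ->; rewrite mulr1.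
apply/eqP; rewrite -subr_eq0; apply: contraT => nz.
have sd : (size (g - \sum_(j in P) c j *: b j)%R <= n.+1)%N.
  apply: leq_trans (size_polyD _ _) _; rewrite size_polyN geq_max sg /=.
  apply: leq_trans (size_sum _ _ _) _; apply/bigmax_leqP => j jP.
  by apply: leq_trans (size_scale_leq _ _) _; rewrite sb.
suff : (n.+1 < size (g - \sum_(j in P) c j *: b j)%R)%N by rewrite ltnNge sd.
rewrite -cP cardE -(size_map r); apply: max_poly_roots nz _ _; last first.
  by rewrite map_inj_in_uniq ?enum_uniq // => x y; rewrite !mem_enum; exact: rI.
apply/allP => y /mapP [j]; rewrite mem_enum => jP ->.
rewrite rootE hornerD hornerN horner_sum (bigD1 j) //= big1 ?addr0; last first.
  move=> i /andP [iP ij]; rewrite hornerZ horner_prod (bigD1 j) /=.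
    by rewrite hornerXsubC subrr mul0r mulr0.
  by rewrite !inE jP eq_sym ij.
rewrite hornerZ horner_prod.
under [X in _ * X]eq_bigr do rewrite hornerXsubC.
rewrite /c divfK ?subrr //; apply/prodf_neq0 => i; rewrite !inE => /andP [ij iP].
by rewrite subr_eq0; apply: contraNneq ij => /rI ->.
Qed.
End Lagrange.

(** * Orientations and determinants *)

Section Orientation.
Variables (K : fieldType) (n m : nat) (a : 'M[K]_(n, m)).
Implicit Types s t : n.-tuple 'I_m.

Lemma simplex_det_perm s (g : 'S_n) :
  simplex_det a [tuple tnth s (g i) | i < n] = (-1) ^+ g * simplex_det a s.
Proof.
have -> : simplex_det a [tuple tnth s (g i) | i < n]
        = \det (col_perm g (simplex_mx a s)).
  by congr (\det _); apply/matrixP => p q; rewrite !mxE tnth_mktuple.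
by rewrite col_permE det_mulmx det_perm odd_permV mulrC.
Qed.

Lemma same_orientation_det s t :
  same_orientation s t -> simplex_det a t = simplex_det a s.
Proof.
case/existsP => g /andP [/negbTE eg /eqP ->].
by rewrite simplex_det_perm eg mul1r.
Qed.

Lemma opposite_orientation_det s t : perm_eq s t -> ~~ same_orientation s t ->
  simplex_det a t = - simplex_det a s.
Proof.
rewrite perm_sym => /tuple_permP [g /val_inj ->] /existsPn /(_ g).
by rewrite eqxx andbT negbK => og; rewrite simplex_det_perm og expr1 mulN1r.
Qed.

(** Up to sign both products are the determinant of [u] times that of [u'], and
the signs differ because exactly one of [u], [u'] is positive.  In
characteristic 2, where [o] need not be coherent, every sign is 1. *)
Lemma coherent_det (k : fieldType) (D : {set {set 'I_m}})
    (o : {set 'I_m} -> n.-tuple 'I_m) (F G : {set 'I_m}) (u u' : n.-tuple 'I_m) :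
  (2%N \in [pchar k] -> 2%N \in [pchar K]) -> oriented_over k D o ->
  F \in facets D -> G \in facets D -> F != G ->
  perm_eq u (enum F) -> perm_eq u' (enum G) -> behead u = behead u' ->
  simplex_det a (o F) * simplex_det a u'
    = - (simplex_det a (o G) * simplex_det a u).
Proof.
move=> chK [oP coh] FD GD FG uF uG uu'.
have oF : perm_eq (o F) u by apply: perm_trans (oP _ FD) _; rewrite perm_sym.
have oG : perm_eq (o G) u' by apply: perm_trans (oP _ GD) _; rewrite perm_sym.
have sgn s t : perm_eq s t -> simplex_det a t
    = (if same_orientation s t then 1 else -1) * simplex_det a s.
  move=> st; case: ifP => [/same_orientation_det ->|/negbT so].
    by rewrite mul1r.
  by rewrite (opposite_orientation_det st so) mulN1r.
rewrite (sgn _ _ oF) (sgn _ _ oG).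
have [/chK ch2|ch2] := boolP (2%N \in [pchar k]).
  rewrite (oppr_pchar2 ch2) oppr_pchar2 // !if_same !mul1r.
  exact: mulrC.
rewrite (coh ch2 F G FD GD FG u u' uF uG uu').
case: same_orientation => /=; ring.
Qed.

End Orientation.

(** By linearity of the determinant in its first column, the sum is the
determinant of a matrix with first column [a X = 0]. *)
Lemma sum_kernel_simplex_det (K : fieldType) (n m : nat) (a : 'M[K]_(n.+1, m))
    (X : 'I_m -> K) (r : n.-tuple 'I_m) :
  (forall p, \sum_j a p j * X j = 0) ->
  \sum_j X j * simplex_det a [tuple of j :: r] = 0.
Proof.
move=> aX; pose c j p := cofactor (simplex_mx a [tuple of j :: r]) p ord0.
have cE j j' p : c j p = c j' p.
  rewrite /c /cofactor; congr (_ * \det _).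
  by apply/matrixP => p' q; rewrite !mxE !(tnth_nth j).
under eq_bigr => j _ do rewrite /simplex_det (expand_det_col _ ord0) mulr_sumr.
rewrite exchange_big big1 // => p _ /=.
case: (pickP (xpredT : pred 'I_m)) => [j0 _|no]; last first.
  by apply: big1 => j; have := no j.
transitivity ((\sum_j a p j * X j) * c j0 p); last by rewrite aX mul0r.
rewrite mulr_suml; apply: eq_bigr => j _.
by rewrite mulrA [X j * _]mulrC -/(c j p) (cE j j0) !mxE.
Qed.

Lemma simplex_det_cons_in (K : fieldType) (n m : nat) (a : 'M[K]_(n.+1, m))
    (r : n.-tuple 'I_m) j :
  j \in r -> simplex_det a [tuple of j :: r] = 0.
Proof.
case/tnthP => q jq; rewrite /simplex_det -det_tr.
apply: (@determinant_alternate _ _ _ ord0 (lift ord0 q)) => // p.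
by rewrite !mxE tnth0 tnthS -jq.
Qed.

(** Cramer's rule in homogeneous form: in the relation above, the columns that
repeat an entry of [r] contribute nothing, so only [v] and [w] remain. *)
Lemma kernel_exchange (K : fieldType) (n m : nat) (a : 'M[K]_(n.+1, m))
    (X : 'I_m -> K) (r : n.-tuple 'I_m) v w :
  (forall p, \sum_j a p j * X j = 0) -> v != w ->
  (forall j, j \notin [:: v, w & r] -> X j = 0) ->
  X v * simplex_det a [tuple of v :: r] = - (X w * simplex_det a [tuple of w :: r]).
Proof.
move=> /sum_kernel_simplex_det - /(_ r) aX vw X0; apply/eqP; rewrite -addr_eq0.
rewrite -[Y in _ == Y]aX (bigD1 v) //= (bigD1 w) /=; last by rewrite eq_sym.
rewrite addrA.
rewrite [Y in _ == _ + Y]big1 ?addr0 // => j /andP [jv jw].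
have [jr|jr] := boolP (j \in r); first by rewrite simplex_det_cons_in ?mulr0.
by rewrite X0 ?mul0r // !inE (negbTE jv) (negbTE jw).
Qed.

(** * Evaluation points of simplices *)

Lemma big_ordering (R : Type) (idx : R) (op : Monoid.com_law idx) (n m : nat)
    (s : n.-tuple 'I_m) (G : {set 'I_m}) (F : 'I_m -> R) :
  perm_eq s (enum G) ->
  \big[op/idx]_(j in G) F j = \big[op/idx]_q F (tnth s q).
Proof. by move=> sG; rewrite -big_enum -(perm_big _ sG) big_tuple. Qed.

Lemma ordering_uniq (n m : nat) (s : n.-tuple 'I_m) (G : {set 'I_m}) :
  perm_eq s (enum G) -> uniq s.
Proof. by move/perm_uniq ->; apply: enum_uniq. Qed.

Lemma mem_ordering (n m : nat) (s : n.-tuple 'I_m) (G : {set 'I_m}) :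
  perm_eq s (enum G) -> s =i G.
Proof. by move/perm_mem => sG j; rewrite sG mem_enum. Qed.

Lemma mmap_ext (n : nat) (R S : nzRingType) (h : R -> S) (x y : 'I_n -> S)
    (f : {mpoly R[n]}) : x =1 y -> mmap h x f = mmap h y f.
Proof. by move=> xy; apply: eq_bigr => e _; rewrite (mmap1_eq _ xy). Qed.

Lemma mmap_comp (n m : nat) (R S : comNzRingType) (h : {rmorphism R -> S})
    (x : 'I_m -> S) (lp : n.-tuple {mpoly R[m]}) (f : {mpoly R[n]}) :
  mmap h x (f \mPo lp) = mmap h (fun i => mmap h x (tnth lp i)) f.
Proof.
rewrite comp_mpolyEX raddf_sum /=; apply: eq_bigr => e _.
rewrite mmapZ comp_mpolyX rmorph_prod; congr (_ * _).
by apply: eq_bigr => i _; rewrite rmorphXn.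
Qed.

Section Points.
Variables (K : fieldType) (n m : nat) (a : 'M[K]_(n, m)).

Definition embed : K -> {fraction {mpoly K[n]}} := @tofrac _ \o @mpolyC n K.

HB.instance Definition _ := GRing.RMorphism.on embed.

(** The point at which a polynomial must be evaluated to obtain its image under
setting to zero the variables off [G] and inverting [phi]. *)
Definition point_over (G : {set 'I_m}) (x : 'I_m -> {fraction {mpoly K[n]}}) :=
  (forall j, j \notin G -> x j = 0) /\
  (forall p, \sum_j embed (a p j) * x j = tofrac 'X_p).

Definition point_coord (s : n.-tuple 'I_m) q : {fraction {mpoly K[n]}} :=
  \sum_p embed (invmx (simplex_mx a s) q p) * tofrac 'X_p.

Definition point_of (s : n.-tuple 'I_m) (j : 'I_m) : {fraction {mpoly K[n]}} :=
  if [pick q | tnth s q == j] is Some q then point_coord s q else 0.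

Variables (s : n.-tuple 'I_m) (G : {set 'I_m}).
Hypotheses (sG : perm_eq s (enum G)) (det_s : simplex_det a s != 0).

Let unit_s : simplex_mx a s \in unitmx.
Proof. by rewrite unitmxE unitfE. Qed.

Lemma point_of_over : point_over G (point_of s).
Proof.
split=> [j|p].
  rewrite -(mem_ordering sG) /point_of => js; case: pickP => // q /eqP e.
  by rewrite -e mem_tnth in js.
rewrite (bigID (mem G)) /= [Y in _ + Y]big1 ?addr0; last first.
  move=> j; rewrite -(mem_ordering sG) /point_of => js.
  case: pickP => [q /eqP e|_]; last by rewrite mulr0.
  by rewrite -e mem_tnth in js.
rewrite (big_ordering _ _ sG) /=.
transitivity (\sum_r embed ((1%:M : 'M[K]_n) p r) * tofrac 'X_r); last first.
  rewrite (bigD1 p) //= mxE eqxx rmorph1 mul1r big1 ?addr0 // => r.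
  by rewrite mxE eq_sym => /negbTE ->; rewrite rmorph0 mul0r.
rewrite -(mulmxV unit_s).
under [RHS]eq_bigr do rewrite mxE rmorph_sum mulr_suml.
rewrite [RHS]exchange_big; apply: eq_bigr => q _ /=.
rewrite /point_of pick_tnth ?(ordering_uniq sG) // mulr_sumr.
by apply: eq_bigr => r _; rewrite rmorphM mulrA mxE.
Qed.

Lemma point_over_coord x : point_over G x ->
  forall q, x (tnth s q) = point_coord s q.
Proof.
case=> x0 xt q.
transitivity (\sum_r embed ((1%:M : 'M[K]_n) q r) * x (tnth s r)).
  rewrite (bigD1 q) //= mxE eqxx rmorph1 mul1r big1 ?addr0 // => r.
  by rewrite mxE eq_sym => /negbTE ->; rewrite rmorph0 mul0r.
rewrite -(mulVmx unit_s).
under eq_bigr do rewrite mxE rmorph_sum mulr_suml.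
rewrite exchange_big; apply: eq_bigr => p _ /=.
rewrite -xt (bigID (mem G)) /= [Y in _ + Y]big1 ?addr0; last first.
  by move=> j jG; rewrite x0 ?mulr0.
rewrite (big_ordering _ _ sG) /= mulr_sumr.
by apply: eq_bigr => r _; rewrite rmorphM mulrA mxE.
Qed.

Lemma point_over_unique x : point_over G x -> x =1 point_of s.
Proof.
move=> Gx j; have [jG|jG] := boolP (j \in G); last first.
  by rewrite (proj1 Gx) // (proj1 point_of_over).
rewrite -(mem_ordering sG) in jG; have /tnthP [q ->] := jG.
by rewrite (point_over_coord Gx) (point_over_coord point_of_over).
Qed.

(** The coordinate at the [q]-th vertex is the linear form given by the [q]-th row
of the inverse matrix; it takes the value 1 at the [q]-th column of the matrix. *)
Lemma point_over_neq0 x : point_over G x -> {in G, forall j, x j != 0}.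
Proof.
move=> Gx j; rewrite -(mem_ordering sG) => /tnthP [q ->].
rewrite (point_over_coord Gx).
pose c := \sum_p (invmx (simplex_mx a s) q p) *: ('X_p : {mpoly K[n]}).
have -> : point_coord s q = tofrac c.
  by rewrite rmorph_sum; apply: eq_bigr => p _; rewrite -mul_mpolyC rmorphM.
rewrite tofrac_eq0; apply/eqP => /(congr1 (meval (fun p => a p (tnth s q)))).
rewrite meval0 raddf_sum /=; apply/eqP.
have -> : \sum_p meval (fun p => a p (tnth s q))
      (invmx (simplex_mx a s) q p *: 'X_p) = (1%:M : 'M[K]_n) q q.
  rewrite -(mulVmx unit_s) mxE; apply: eq_bigr => p _.
  by rewrite mevalZ mevalXU mxE.
by rewrite mxE eqxx oner_eq0.
Qed.

Lemma tofrac_phi_inv x (f : {mpoly K[m]}) : point_over G x ->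
  tofrac (phi_inv a s f) = mmap embed x f.
Proof.
move=> Gx; rewrite (mmap_ext _ _ (point_over_unique Gx)) /phi_inv comp_mpolyEX.
rewrite rmorph_sum; apply: eq_bigr => e _.
rewrite -mul_mpolyC rmorphM comp_mpolyX rmorph_prod; congr (_ * _).
apply: eq_bigr => j _; rewrite tnth_mktuple rmorphXn /point_of /=.
congr (_ ^+ _); case: pickP => [q _|_]; last by rewrite rmorph0.
by rewrite rmorph_sum; apply: eq_bigr => p _; rewrite -mul_mpolyC rmorphM.
Qed.

(** Since [x] depends on the set [G] alone, the ordering [s] enters only through
its determinant; this is what lets terms of different orderings cancel. *)
Lemma summandE x (f : {mpoly K[m]}) : point_over G x ->
  tofrac (phi_inv a s f) / tofrac (chi a s)
    = mmap embed x f / (embed (simplex_det a s) * \prod_(j in G) x j).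
Proof.
move=> Gx; rewrite (tofrac_phi_inv _ Gx); congr (_ / _).
rewrite /chi -mul_mpolyC rmorphM /= (tofrac_phi_inv _ Gx) rmorph_prod /=.
rewrite (big_ordering _ _ sG) /=; congr (_ * _).
by apply: eq_bigr => q _; rewrite mmapX mmap1U.
Qed.

End Points.

(** * The boundary of a simplex *)

(** Restricting a form of degree [n] to the line [y - l z] gives a polynomial in
[l] whose coefficient of degree [n] is the value of the form at [- z]. *)
Lemma mmap_linear_top (K L : fieldType) (h : {rmorphism K -> L}) (n m : nat)
    (y z : 'I_m -> L) (f : {mpoly K[m]}) :
  f \is n.-homog ->
  let g := mmap (polyC \o h) (fun i => (y i)%:P - z i *: 'X) f in
  [/\ (size g <= n.+1)%N,
      g`_n = (-1) ^+ n * mmap h z f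
    & forall l, g.[l] = mmap h (fun i => y i - l * z i) f].
Proof.
move=> f_homog g.
pose lin i : {poly L} := (y i)%:P - z i *: 'X.
have slin i : (size (lin i) <= 2)%N.
  rewrite (leq_trans (size_polyD _ _)) // geq_max size_polyN.
  rewrite (leq_trans (size_polyC_leq1 _)) //=.
  by rewrite (leq_trans (size_scale_leq _ _)) // size_polyX.
have top e : e \in msupp f ->
    (size (mmap1 lin e) <= n.+1)%N /\ (mmap1 lin e)`_n = (-1) ^+ n * mmap1 z e.
  move=> ef; have <- : mdeg e = n by apply: (dhomog_mf f_homog ef).
  have [] := @coef_prod_top _ _ (index_enum 'I_m) (fun i => lin i ^+ e i) (fun i => e i).
    by move=> i; case: (coef_exp_top (e i) (slin i)).
  rewrite -!mdegE => s1 s2; split=> //; rewrite s2 mdegE -prodrXr /mmap1 -big_split /=.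
  apply: eq_bigr => i _; rewrite (coef_exp_top (e i) (slin i)).2.
  by rewrite coefB coefC coefZ coefX /= sub0r mulr1 [LHS]exprNn.
split=> [||l].
- apply: leq_trans (size_sum _ _ _) _; apply/bigmax_leqP_seq => e ef _.
  apply: leq_trans (size_polyMleq _ _) _.
  have := size_polyC_leq1 (h f@_e); have := (top e ef).1.
  move: (size _) (size _) => p q; lia.
- rewrite coef_sum mulr_sumr !big_seq; apply: eq_bigr => e ef.
  by rewrite coefCM (top e ef).2 mulrCA.
rewrite horner_sum; apply: eq_bigr => e _; rewrite hornerM hornerC horner_prod.
congr (_ * _); apply: eq_bigr => i _.
by rewrite horner_exp !hornerE mulrC.
Qed.

Section ConeSum.
Variables (K : fieldType) (n m : nat) (a : 'M[K]_(n, m)).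
Variables (P : {set 'I_m}) (X : 'I_m -> K) (o : {set 'I_m} -> n.-tuple 'I_m).
Hypotheses (cardP : #|P| = n.+1) (aX : forall p, \sum_j a p j * X j = 0).
Hypotheses (X0 : forall j, j \notin P -> X j = 0).
Hypotheses (X_neq0 : {in P, forall j, X j != 0}).
Hypotheses (oP : {in P, forall j, perm_eq (o (P :\ j)) (enum (P :\ j))}).
Hypotheses (det_o : {in P, forall j, simplex_det a (o (P :\ j)) = X j}).

(** The points of the facets of [P] lie on the line through any one of them in
the kernel direction [X], at parameters [r j]; the sum is then a Lagrange
interpolation sum with these nodes. *)
Lemma boundary_sum (f : {mpoly K[m]}) : f \is n.-homog ->
  \sum_(j in P) tofrac (phi_inv a (o (P :\ j)) f) / tofrac (chi a (o (P :\ j)))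
    = embed n ((\prod_(j in P) X j)^-1 * f.@[X]).
Proof.
move=> f_homog; pose h := embed n : {rmorphism K -> {fraction {mpoly K[n]}}}.
have /card_gt0P [j0 j0P] : (0 < #|P|)%N by rewrite cardP.
have d0 j : j \in P -> simplex_det a (o (P :\ j)) != 0.
  by move=> jP; rewrite det_o ?X_neq0.
have hX j : j \in P -> h (X j) != 0 by move=> jP; rewrite fmorph_eq0 X_neq0.
pose y := point_of a (o (P :\ j0)).
have [y0 yt] : point_over a (P :\ j0) y := point_of_over (oP j0P) (d0 _ j0P).
pose r j := y j / h (X j).
pose x j i := y i - r j * h (X i).
have xP j : j \in P -> point_over a (P :\ j) (x j).
  move=> jP; split=> [i|p].
    rewrite !inE negb_and negbK => /orP [/eqP ->|iP].
      by rewrite /x divfK ?hX ?subrr.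
    by rewrite /x X0 // rmorph0 mulr0 subr0 y0 // !inE (negbTE iP) andbF.
  under eq_bigr do rewrite mulrBr mulrCA -rmorphM.
  by rewrite sumrB -mulr_sumr -rmorph_sum aX rmorph0 mulr0 subr0 yt.
have xE j i : i \in P -> x j i = h (X i) * (r i - r j).
  by move=> iP; rewrite mulrBr [RHS]addrC mulrC [_ * r i]mulrC divfK ?hX // addrC.
have r_inj : {in P &, injective r}.
  move=> i j iP jP rij; apply/eqP; apply: contraT => ij.
  have := point_over_neq0 (oP jP) (d0 _ jP) (xP j jP).
  move/(_ i); rewrite !inE ij iP xE // rij subrr mulr0 eqxx.
  by move/(_ isT).
have [sg gn gr] := mmap_linear_top h y (h \o X) f_homog.
have fX : mmap h (h \o X) f = h f.@[X].
  rewrite mevalE rmorph_sum; apply: eq_bigr => e _.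
  rewrite rmorphM rmorph_prod; congr (_ * _).
  by apply: eq_bigr => i _; rewrite rmorphXn.
(* The sign from the reversed differences of the nodes meets the one of f(-X). *)
have sgn2 : ((-1) ^+ n * (-1) ^+ n = 1 :> {fraction {mpoly K[n]}}).
  by rewrite -exprD addnn -mul2n exprM sqrrN !expr1n.
transitivity (h (\prod_(j in P) X j)^-1 * (-1) ^+ n * \sum_(j in P)
    (mmap (polyC \o h) (fun i => (y i)%:P - h (X i) *: 'X) f).[r j]
      / \prod_(i in P :\ j) (r j - r i)); last first.
  rewrite (lagrange_top_coef cardP r_inj sg) gn fX mulrA -[_ * _ * _ ^+ n]mulrA.
  by rewrite sgn2 mulr1 rmorphM.
rewrite mulr_sumr; apply: eq_bigr => j jP.
rewrite (summandE (oP jP) (d0 _ jP) _ (xP _ jP)) det_o // gr.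
have -> : \prod_(i in P :\ j) x j i = h (\prod_(i in P :\ j) X i)
    * ((-1) ^+ n * \prod_(i in P :\ j) (r j - r i)).
  have -> : (-1) ^+ n = \prod_(i in P :\ j) (-1) :> {fraction {mpoly K[n]}}.
    by rewrite prodr_const cardsDS ?sub1set // cardP cards1 subn1.
  rewrite rmorph_prod -!big_split; apply: eq_bigr => i; rewrite inE => /andP [_ iP].
  by rewrite xE //= mulN1r opprB.
rewrite (bigD1 j jP) /= rmorphV ?unitfE; last first.
  rewrite mulf_neq0 ?X_neq0 //; apply/prodf_neq0 => i /andP [iP _].
  exact: X_neq0.
rewrite rmorphM.
have -> : \prod_(i in P | i != j) X i = \prod_(i in P :\ j) X i.
  by apply: eq_bigl => i; rewrite !inE andbC.
rewrite !invfM -signr_odd invr_sign signr_odd.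
ring.
Qed.
End ConeSum.

(** * Cones and their minors *)

Lemma dhomog_comp (R : comNzRingType) (n m d : nat) (f : {mpoly R[n]})
    (lp : n.-tuple {mpoly R[m]}) :
  f \is d.-homog -> (forall i, tnth lp i \is 1.-homog) -> f \mPo lp \is d.-homog.
Proof.
move=> f_homog lp_homog; rewrite comp_mpolyEX big_seq; apply: rpred_sum => e ef.
have <- : mdeg e = d := dhomog_mf f_homog ef.
apply: dhomogZ; rewrite comp_mpolyX mdegE.
pose de := [tuple e i | i < n]; pose pe := [tuple tnth lp i ^+ e i | i < n].
have -> : (\sum_i e i = \sum_(i <- de) i)%N.
  by rewrite big_tuple; apply: eq_bigr => i _; rewrite tnth_mktuple.
have -> : \prod_i tnth lp i ^+ e i = \prod_(p <- pe) p.
  by rewrite big_tuple; apply: eq_bigr => i _; rewrite tnth_mktuple.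
apply: dhomog_prod => i; rewrite !tnth_mktuple -[X in X.-homog]mul1n.
exact: dhomogMn.
Qed.

Lemma ordering_intro (n m : nat) (s : n.-tuple 'I_m) (G : {set 'I_m}) :
  uniq s -> s =i G -> perm_eq s (enum G).
Proof.
move=> us sG; apply: uniq_perm; rewrite ?enum_uniq // => j.
by rewrite mem_enum sG.
Qed.

Lemma ordering_exists (n m : nat) (G : {set 'I_m}) : #|G| = n ->
  exists s : n.-tuple 'I_m, perm_eq s (enum G).
Proof.
move=> cG; have sz : size (enum G) == n by rewrite -cardE cG.
by exists (Tuple sz).
Qed.

Lemma ordering_cons (n m : nat) (r : n.-tuple 'I_m) (R : {set 'I_m}) j :
  perm_eq r (enum R) -> j \notin R -> perm_eq [tuple of j :: r] (enum (j |: R)).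
Proof.
move=> rR jR; apply: ordering_intro => [|i] /=.
  by rewrite (mem_ordering rR) jR (ordering_uniq rR).
by rewrite !inE (mem_ordering rR).
Qed.

(** The ridges of a facet are described both by the vertex they miss and by
their size; the second form makes sense without mentioning the facet, which
allows the summations over facets and ridges to be exchanged. *)
Lemma setD1_imset_card (T : finType) (n : nat) (F R : {set T}) : #|F| = n.+1 ->
  (R \in [set F :\ j | j in F]) = (R \subset F) && (#|R| == n).
Proof.
move=> cF; apply/imsetP/andP => [[j jF ->]|[RF /eqP cR]].
  by rewrite subD1set cardsDS ?sub1set // cF cards1 subn1.
have /cards1P [j jE] : #|F :\: R| == 1%N by rewrite cardsDS // cF cR subSnn.
have jF : j \in F by have := set11 j; rewrite -jE !inE => /andP [].
by exists j => //; rewrite -jE setDDr setDv set0U; apply/esym/setIidPr.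
Qed.

Lemma setD1_inj (T : finType) (F : {set T}) : {in F &, injective (fun j => F :\ j)}.
Proof.
move=> i j iF jF /setP /(_ j); rewrite !inE eqxx jF andbT /=.
by move/negbFE/eqP.
Qed.

Lemma facets_proper (m : nat) (P : {set 'I_m}) :
  facets [set G : {set 'I_m} | G \proper P] = [set P :\ j | j in P].
Proof.
apply/setP => G; rewrite inE; apply/idP/imsetP => [maxG|[j jP ->]].
  have := maxsetp maxG; rewrite /= inE => /properP [GP [j jP jG]].
  exists j => //; apply/esym; apply: (maxsetsup maxG).
    by rewrite /= inE properD1.
  by rewrite subsetD1 GP.
apply/maxsetP; split=> [|B]; first by rewrite /= inE properD1.
rewrite /= inE => /properP [BP [i iP iB]] sub.
have ij : i = j.
  by apply/eqP; apply: contraNT iB => ij; apply: (subsetP sub); rewrite !inE ij.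
by apply/eqP; rewrite eqEsubset sub subsetD1 BP -ij iB.
Qed.

Section OldVertices.
Variable N : nat.
Implicit Types (F : {set 'I_N}) (j : 'I_N).

Definition cone_vertices F : {set 'I_N.+1} := ord0 |: old_vertices F.

Lemma mem_old F j : (lift ord0 j \in old_vertices F) = (j \in F).
Proof. by rewrite mem_imset //; apply: lift_inj. Qed.

Lemma ord0_old F : ord0 \notin old_vertices F.
Proof. by apply/imsetP => -[j _ /eqP]; rewrite (negbTE (neq_lift _ _)). Qed.

Lemma cone_minus_apex F : cone_vertices F :\ ord0 = old_vertices F.
Proof.
apply/setP => j; rewrite !inE; case: eqP => [->|] //=.
by rewrite (negbTE (ord0_old F)).
Qed.

Lemma cone_minus_old F j :
  cone_vertices F :\ lift ord0 j = cone_vertices (F :\ j).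
Proof.
apply/setP => i; rewrite !inE; case: (unliftP ord0 i) => [i' ->|->].
  by rewrite [_ == ord0]eq_sym (negbTE (neq_lift _ _)) !mem_old !inE /= (inj_eq lift_inj).
by rewrite eqxx neq_lift.
Qed.

Lemma card_cone F : #|cone_vertices F| = #|F|.+1.
Proof. by rewrite cardsU1 ord0_old card_imset //; apply: lift_inj. Qed.

Lemma ordering_old n (s : n.-tuple 'I_N) F :
  perm_eq s (enum F) -> perm_eq (old_tuple s) (enum (old_vertices F)).
Proof.
move=> sF; apply: ordering_intro => [|i].
  by rewrite map_inj_uniq ?(ordering_uniq sF) //; apply: lift_inj.
apply/mapP/imsetP => -[j jF ->]; exists j => //.
  by rewrite -(mem_ordering sF).
by rewrite (mem_ordering sF).
Qed.

Lemma facets_cone F :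
  facets (cone_boundary F) = [set cone_vertices F :\ j | j in cone_vertices F].
Proof. exact: facets_proper. Qed.

Lemma cone_facet F i : i \in cone_vertices F ->
  cone_vertices F :\ i \in facets (cone_boundary F).
Proof. by move=> iF; rewrite facets_cone; apply/imsetP; exists i. Qed.

Lemma cone_facet_old F : old_vertices F \in facets (cone_boundary F).
Proof. by rewrite -cone_minus_apex cone_facet // in_setU1 eqxx. Qed.

Lemma cone_facet_apex F j : j \in F ->
  cone_vertices (F :\ j) \in facets (cone_boundary F).
Proof.
by move=> jF; rewrite -cone_minus_old cone_facet // in_setU1 mem_old jF orbT.
Qed.

End OldVertices.

(** The polynomial whose mixed volume over the boundary of the cone on [F]
defines [mixed_volume_cone]. *)
Definition on_old_vertices (K : fieldType) N (F : {set 'I_N}) (f : {mpoly K[N]}) :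
    {mpoly K[N.+1]} :=
  f \mPo [tuple (if j \in F then 'X_(lift ord0 j) else 0) | j < N].

Lemma mmap_on_old (K : fieldType) (S : comNzRingType) (h : {rmorphism K -> S})
    N (F : {set 'I_N}) (f : {mpoly K[N]}) (x : 'I_N.+1 -> S) :
  (forall j, j \notin F -> x (lift ord0 j) = 0) ->
  mmap h x (on_old_vertices F f) = mmap h (fun j => x (lift ord0 j)) f.
Proof.
move=> x0; rewrite mmap_comp; apply: mmap_ext => j; rewrite tnth_mktuple.
by case: ifP => jF; [rewrite mmapX mmap1U | rewrite mmap0 x0 ?jF].
Qed.

Lemma on_old_homog (K : fieldType) N (F : {set 'I_N}) (f : {mpoly K[N]}) d :
  f \is d.-homog -> on_old_vertices F f \is d.-homog.
Proof.
move=> f_homog; apply: dhomog_comp => // j; rewrite tnth_mktuple.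
by case: ifP => _; rewrite ?rpred0 // dhomogX; apply/eqP/mdeg1.
Qed.

(** Repeating row [p] on top of [cone_mx a s] gives a singular square matrix;
expand its determinant along the top row. *)
Lemma cone_minor_kernel (K : fieldType) n N (a : 'M[K]_(n, N.+1))
    (s : n.-tuple 'I_N) p :
  \sum_q cone_mx a s p q * cone_minor a s q = 0.
Proof.
pose B : 'M[K]_n.+1 :=
  \matrix_(i, j) cone_mx a s (if unlift ord0 i is Some i' then i' else p) j.
transitivity (\det B); last first.
  apply: (@determinant_alternate _ _ _ ord0 (lift ord0 p)) => // q.
  by rewrite !mxE unlift_none liftK.
rewrite (expand_det_row _ ord0); apply: eq_bigr => q _.
rewrite !mxE unlift_none /cofactor add0n; congr (_ * (_ * \det _)).
by apply/matrixP => i j; rewrite !mxE liftK.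
Qed.

Section ConeMinors.
Variables (K k : fieldType) (n N : nat) (a : 'M[K]_(n.+1, N.+1)).
Hypothesis pchar2 : 2%N \in [pchar k] -> 2%N \in [pchar K].
Hypothesis generic : forall t : n.+1.-tuple 'I_N.+1, uniq t -> simplex_det a t != 0.
Variables (F : {set 'I_N}) (s : n.+1.-tuple 'I_N).
Variable oPi : {set 'I_N.+1} -> n.+1.-tuple 'I_N.+1.
Hypothesis sF : perm_eq s (enum F).
Hypothesis oriented : oriented_over k (cone_boundary F) oPi.
Hypothesis same : same_orientation (old_tuple s) (oPi (old_vertices F)).

Let cone_tuple : n.+2.-tuple 'I_N.+1 := [tuple of ord0 :: old_tuple s].

(** The signed minors, extended by zero to a vector indexed by all vertices. *)
Definition minor_at (j : 'I_N.+1) : K :=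
  if [pick q | tnth cone_tuple q == j] is Some q then cone_minor a s q else 0.

Lemma ordering_cone : perm_eq cone_tuple (enum (cone_vertices F)).
Proof. by apply: ordering_cons; rewrite ?ord0_old // ordering_old. Qed.

Lemma minor_at_tnth q : minor_at (tnth cone_tuple q) = cone_minor a s q.
Proof. by rewrite /minor_at pick_tnth // (ordering_uniq ordering_cone). Qed.

Lemma minor_at_out j : j \notin cone_vertices F -> minor_at j = 0.
Proof.
rewrite -(mem_ordering ordering_cone) /minor_at => jF.
by case: pickP => // q /eqP e; rewrite -e mem_tnth in jF.
Qed.

Lemma minor_at_kernel p : \sum_j a p j * minor_at j = 0.
Proof.
rewrite (bigID (mem (cone_vertices F))) /= [Y in _ + Y]big1 ?addr0; last first.
  by move=> j jF; rewrite minor_at_out ?mulr0.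
rewrite (big_ordering _ _ ordering_cone) -[RHS](cone_minor_kernel a s p) /=.
by apply: eq_bigr => q _; rewrite minor_at_tnth mxE.
Qed.

Lemma minor_at_apex : minor_at ord0 = simplex_det a (oPi (old_vertices F)).
Proof.
rewrite (same_orientation_det a same) -[X in minor_at X](tnth0 ord0 (old_tuple s)).
rewrite minor_at_tnth /cone_minor expr0 mul1r; congr (\det _).
by apply/matrixP => p q; rewrite !mxE tnthS.
Qed.

Lemma minor_at_lift j : minor_at (lift ord0 j)
  = if [pick q | tnth s q == j] is Some q then cone_minor a s (lift ord0 q) else 0.
Proof.
case: pickP => [q /eqP <-|no].
  by rewrite -minor_at_tnth tnthS tnth_map.
apply: minor_at_out; rewrite !inE eq_sym (negbTE (neq_lift _ _)) mem_old.
by rewrite -(mem_ordering sF); apply/negP => /tnthP [q qj]; have := no q; rewrite qj eqxx.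
Qed.

Lemma cone_oPi_ordering : {in cone_vertices F, forall j,
  perm_eq (oPi (cone_vertices F :\ j)) (enum (cone_vertices F :\ j))}.
Proof. by move=> j jF; apply: oriented.1; apply: cone_facet. Qed.

(** Coherence in the boundary of the cone and the kernel relation for the minors
are the same exchange rule between the facet opposite to the apex and the facet
opposite to [j], so the agreement at the apex propagates to every [j]. *)
Lemma minor_at_det : {in cone_vertices F, forall j,
  simplex_det a (oPi (cone_vertices F :\ j)) = minor_at j}.
Proof.
have cF : #|F| = n.+1 by rewrite cardE -(perm_size sF) size_tuple.
move=> j; rewrite in_setU1 => /orP [/eqP ->|/imsetP [i iF ->{j}]].
  by rewrite cone_minus_apex minor_at_apex.
set j := lift ord0 i.
have j0 : ord0 != j by apply: neq_lift.
have jF : j \in old_vertices F by rewrite mem_old.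
have /ordering_exists [r rR] : #|F :\ i| = n.
  by rewrite cardsDS ?sub1set // cF cards1 subn1.
have roR := ordering_old rR.
have uP : perm_eq [tuple of j :: old_tuple r] (enum (old_vertices F)).
  suff -> : old_vertices F = j |: old_vertices (F :\ i).
    by apply: ordering_cons; rewrite // mem_old !inE eqxx.
  by rewrite /old_vertices -imsetU1 setD1K.
have uP' : perm_eq [tuple of ord0 :: old_tuple r] (enum (cone_vertices F :\ j)).
  by rewrite cone_minus_old; apply: ordering_cons; rewrite ?ord0_old.
have det_u := generic (ordering_uniq uP).
have oldG : old_vertices F != cone_vertices F :\ j.
  apply/eqP => /setP /(_ ord0); rewrite !inE (negbTE (ord0_old F)) j0.
  by [].
have GP : cone_vertices F :\ j \in facets (cone_boundary F).
  by rewrite cone_facet // in_setU1 jF orbT.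
have := coherent_det a pchar2 oriented (cone_facet_old F) GP oldG uP uP' erefl.
have X0 i' : i' \notin [:: ord0, j & old_tuple r] -> minor_at i' = 0.
  move=> i'r; apply: minor_at_out; apply: contra i'r.
  rewrite in_setU1 !in_cons (mem_ordering roR) => /orP [-> //|/imsetP [l lF ->]].
  by rewrite /j (inj_eq lift_inj) mem_old !inE lF andbT orbN orbT.
have := kernel_exchange minor_at_kernel j0 X0.
rewrite -minor_at_apex => -> /oppr_inj /(mulIf det_u) ->.
by [].
Qed.

Lemma cone_mixed_volume_sum (f : {mpoly K[N]}) : f \is n.+1.-homog ->
  mixed_volume_sum a (cone_boundary F) oPi (on_old_vertices F f)
    = embed n.+1 ((cone_const a s)^-1 * cone_ev a s f).
Proof.
move=> f_homog; have cF : #|F| = n.+1 by rewrite cardE -(perm_size sF) size_tuple.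
rewrite /mixed_volume_sum facets_cone big_imset /=; last exact: setD1_inj.
rewrite (boundary_sum _ minor_at_kernel minor_at_out _ cone_oPi_ordering minor_at_det).
- congr (embed _ (_^-1 * _)).
    rewrite (big_ordering _ _ ordering_cone); apply: eq_bigr => q _.
    exact: minor_at_tnth.
  rewrite /meval (@mmap_on_old _ _ idfun) => [|j jF]; last first.
    by apply: minor_at_out; rewrite in_setU1 eq_sym (negbTE (neq_lift _ _)) mem_old.
  exact: mmap_ext minor_at_lift.
- by rewrite card_cone cF.
- move=> j jF; rewrite -minor_at_det //.
  exact: generic (ordering_uniq (cone_oPi_ordering jF)).
- exact: on_old_homog.
Qed.

End ConeMinors.

(** * Cancellation over the ridges *)

Section Cancellation.
Variables (K k : fieldType) (n N : nat) (a : 'M[K]_(n.+1, N.+1)).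
Hypothesis pchar2 : 2%N \in [pchar k] -> 2%N \in [pchar K].
Hypothesis generic : forall t : n.+1.-tuple 'I_N.+1, uniq t -> simplex_det a t != 0.
Variables (D : {set {set 'I_N}}) (o : {set 'I_N} -> n.+1.-tuple 'I_N).
Variable oPi : {set 'I_N} -> {set 'I_N.+1} -> n.+1.-tuple 'I_N.+1.
Hypothesis D_complex : simplicial_complex D.
Hypothesis D_pure : facets_of_card n.+1 D.
Hypothesis D_ridge : forall R, R \in D -> #|R|.+1 = n.+1 ->
  #|[set G in D | (#|G| == n.+1) && (R \subset G)]| = 2.
Hypothesis D_oriented : oriented_over k D o.
Hypothesis Pi_oriented : forall F, F \in facets D ->
  oriented_over k (cone_boundary F) (oPi F).
Hypothesis Pi_same : forall F, F \in facets D ->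
  same_orientation (old_tuple (o F)) (oPi F (old_vertices F)).

Local Notation a' := (col' ord0 a).

Lemma old_tuple_det (s : n.+1.-tuple 'I_N) :
  simplex_det a (old_tuple s) = simplex_det a' s.
Proof. by congr (\det _); apply/matrixP => p q; rewrite !mxE tnth_map. Qed.

Lemma mem_facets F : (F \in facets D) = (F \in D) && (#|F| == n.+1).
Proof.
apply/idP/andP => [FD|[FD /eqP cF]].
  by rewrite (D_pure FD); move: FD; rewrite inE => /maxsetp.
have [G maxG FG] := maxset_exists FD.
have cG : #|G| = n.+1 by apply: D_pure; rewrite inE.
suff -> : F = G by rewrite inE.
by apply/eqP; rewrite eqEcard FG cG cF leqnn.
Qed.

Definition cone_summand F (f : {mpoly K[N]}) G : {fraction {mpoly K[n.+1]}} :=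
  tofrac (phi_inv a (oPi F G) (on_old_vertices F f)) / tofrac (chi a (oPi F G)).

Lemma oPi_det_old F : F \in facets D ->
  simplex_det a (oPi F (old_vertices F)) = simplex_det a' (o F).
Proof. by move/Pi_same/(same_orientation_det a) ->; apply: old_tuple_det. Qed.

(** Extending the point of [F] by zero at the apex gives the point of the same
simplex viewed in the cone. *)
Lemma cone_summand_old F f : F \in facets D ->
  cone_summand F f (old_vertices F)
    = tofrac (phi_inv a' (o F) f) / tofrac (chi a' (o F)).
Proof.
move=> FD; have oF := D_oriented.1 _ FD.
have oPiF := (Pi_oriented FD).1 _ (cone_facet_old F).
have d0 := generic (ordering_uniq oPiF).
have d0' : simplex_det a' (o F) != 0 by rewrite -oPi_det_old.
pose x := point_of a' (o F).
have Fx : point_over a' F x := point_of_over oF d0'.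
pose y i := if unlift ord0 i is Some j then x j else 0.
have yl j : y (lift ord0 j) = x j by rewrite /y liftK.
have Fy : point_over a (old_vertices F) y.
  split=> [i|p].
    case: (unliftP ord0 i) => [j ->|->]; last by rewrite /y unlift_none.
    by rewrite mem_old yl; apply: Fx.1.
  rewrite big_ord_recl {1}/y unlift_none mulr0 add0r -(Fx.2 p).
  by apply: eq_bigr => j _; rewrite yl mxE.
rewrite /cone_summand (summandE oPiF d0 _ Fy) (summandE oF d0' _ Fx).
rewrite oPi_det_old // mmap_on_old => [|j jF]; last by rewrite yl Fx.1.
rewrite (mmap_ext _ _ yl) big_imset /=; last by move=> ? ? _ _; apply: lift_inj.
by congr (_ / (_ * _)); apply: eq_bigr => j _; rewrite yl.
Qed.

(** Compares the orientation of the facet [F] of the complex with the orientation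
that the simplex joining the apex to the ridge [R] gets from the cone over [F]. *)
Lemma cone_facet_det F R (r : n.-tuple 'I_N) j :
  F \in facets D -> j \in F -> R = F :\ j -> perm_eq r (enum R) ->
  simplex_det a' (o F) * simplex_det a [tuple of ord0 :: old_tuple r]
  = - (simplex_det a (oPi F (cone_vertices R)) * simplex_det a' [tuple of j :: r]).
Proof.
move=> FD jF RE rR; rewrite -oPi_det_old //.
have -> : simplex_det a' [tuple of j :: r]
        = simplex_det a [tuple of lift ord0 j :: old_tuple r].
  by rewrite -old_tuple_det; congr simplex_det; apply: val_inj.
have jR : j \notin R by rewrite RE !inE eqxx.
have FE : F = j |: R by rewrite RE setD1K.
apply: (coherent_det a pchar2 (Pi_oriented FD) (cone_facet_old F)) => //.
- by rewrite RE cone_facet_apex.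
- by apply/eqP => /setP /(_ ord0); rewrite (negbTE (ord0_old F)) in_setU1 eqxx.
- have -> : old_vertices F = lift ord0 j |: old_vertices R.
    by rewrite FE /old_vertices imsetU1.
  by apply: ordering_cons; rewrite ?mem_old // ordering_old.
- by apply: ordering_cons; rewrite ?ord0_old // ordering_old.
Qed.

(** Eliminate the determinant of the apex with the ridge from the two instances
of [cone_facet_det], then apply the coherence of [o] across [R]. *)
Lemma oPi_det_opposite F F' (R : {set 'I_N}) :
  F \in facets D -> F' \in facets D -> F != F' ->
  #|R| = n -> R \subset F -> R \subset F' ->
  simplex_det a (oPi F (cone_vertices R))
    = - simplex_det a (oPi F' (cone_vertices R)).
Proof.
move=> FD FD' FF' cR RF RF'; have [r rR] := ordering_exists cR.
have extend G : G \in facets D -> R \subset G -> exists2 j, j \in G & R = G :\ j.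
  move=> GD RG; apply/imsetP; rewrite (setD1_imset_card _ (D_pure GD)) RG.
  by rewrite cR eqxx.
have [j jF RE] := extend _ FD RF; have [j' jF' RE'] := extend _ FD' RF'.
have e := cone_facet_det FD jF RE rR; have e' := cone_facet_det FD' jF' RE' rR.
have consP (G : {set 'I_N}) i :
    i \in G -> R = G :\ i -> perm_eq [tuple of i :: r] (enum G).
  move=> iG RG; have -> : G = i |: R by rewrite RG setD1K.
  by apply: ordering_cons; rewrite // RG !inE eqxx.
have oF := coherent_det a' pchar2 D_oriented FD FD' FF' (consP _ _ jF RE)
  (consP _ _ jF' RE') erefl.
have det_neq0 (s : n.+1.-tuple 'I_N) : uniq s -> simplex_det a' s != 0.
  by move=> us; rewrite -old_tuple_det generic // map_inj_uniq //; apply: lift_inj.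
have uj := det_neq0 _ (ordering_uniq (consP _ _ jF RE)).
have uF' := det_neq0 _ (ordering_uniq (D_oriented.1 _ FD')).
apply: (mulIf uj); apply: (mulIf uF').
move: e e' oF; set f := simplex_det a' (o F); set f' := simplex_det a' (o F').
set w := simplex_det a _; set u := simplex_det a' _; set u' := simplex_det a' _.
set g := simplex_det a _; set g' := simplex_det a _ => e e' oF.
have -> : g * u = - (f * w) by rewrite e opprK.
have -> : - (f * w) * f' = - (f' * w) * f by ring.
have -> : - (f' * w) * f = g' * (f * u') by rewrite e'; ring.
by rewrite oF; ring.
Qed.

Lemma cone_summand_opposite F F' (R : {set 'I_N}) f :
  F \in facets D -> F' \in facets D -> F != F' ->
  #|R| = n -> R \subset F -> R \subset F' ->
  cone_summand F f (cone_vertices R) + cone_summand F' f (cone_vertices R) = 0.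
Proof.
move=> FD FD' FF' cR RF RF'; set G := cone_vertices R.
have GF E : E \in facets D -> R \subset E -> G \in facets (cone_boundary E).
  move=> ED RE; have : R \in [set E :\ j | j in E].
    by rewrite (setD1_imset_card _ (D_pure ED)) RE cR eqxx.
  by case/imsetP => j jE RE'; rewrite /G RE' cone_facet_apex.
have oG E : E \in facets D -> R \subset E -> perm_eq (oPi E G) (enum G).
  by move=> ED RE; apply: (Pi_oriented ED).1; apply: GF.
have d0 E : E \in facets D -> R \subset E -> simplex_det a (oPi E G) != 0.
  by move=> ED RE; apply: generic; apply: ordering_uniq (oG _ ED RE).
have Gx := point_of_over (oG _ FD RF) (d0 _ FD RF).
rewrite /cone_summand (summandE (oG _ FD RF) (d0 _ FD RF) _ Gx).
rewrite (summandE (oG _ FD' RF') (d0 _ FD' RF') _ Gx).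
have x0 (E : {set 'I_N}) : R \subset E -> forall j, j \notin E ->
    point_of a (oPi F G) (lift ord0 j) = 0.
  move=> RE j jE; apply: Gx.1.
  rewrite in_setU1 eq_sym (negbTE (neq_lift _ _)) mem_old /=.
  by apply: contra jE => /(subsetP RE).
rewrite (mmap_on_old _ _ (x0 _ RF)) (mmap_on_old _ _ (x0 _ RF')).
rewrite (oPi_det_opposite FD FD' FF' cR RF RF').
by rewrite rmorphN mulNr invrN mulrN addNr.
Qed.

(** Split off from each cone the facet opposite to the apex; the remaining terms,
collected by the ridge joined to the apex, cancel in pairs. *)
Lemma sum_cone_boundaries f :
  \sum_(F in facets D) mixed_volume_sum a (cone_boundary F) (oPi F)
      (on_old_vertices F f)
    = mixed_volume_sum a' D o f.
Proof.
rewrite /mixed_volume_sum.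
transitivity (\sum_(F in facets D) (cone_summand F f (old_vertices F)
    + \sum_(R in [set F :\ j | j in F]) cone_summand F f (cone_vertices R))).
  apply: eq_bigr => F FD; rewrite facets_cone big_imset /=; last exact: setD1_inj.
  rewrite (bigD1 ord0) ?in_setU1 ?eqxx //= -/(cone_summand F f _) cone_minus_apex.
  congr (_ + _); rewrite [RHS]big_imset /=; last exact: setD1_inj.
  rewrite (eq_bigl (mem (old_vertices F))); last first.
    move=> i; rewrite in_setU1 /=; case: eqP => [->|_] /=; last by rewrite andbT.
    by rewrite (negbTE (ord0_old F)).
  rewrite big_imset /=; last by move=> ? ? _ _; apply: lift_inj.
  by apply: eq_bigr => j jF; rewrite cone_minus_old.
rewrite big_split /= [X in _ + X](_ : _ = 0) ?addr0.
  by apply: eq_bigr => F FD; apply: cone_summand_old.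
(* From here on the sum runs over ridges first, then over the facets above. *)
rewrite (exchange_big_dep (fun R : {set 'I_N} => #|R| == n)) /=; last first.
  by move=> F R FD; rewrite (setD1_imset_card _ (D_pure FD)) => /andP [].
apply: big1 => R /eqP cR.
rewrite (eq_bigl (fun F => F \in [set G in D | (#|G| == n.+1) && (R \subset G)])).
  2: move=> F; rewrite [RHS]inE andbA -mem_facets.
  2: case FD: (F \in facets D) => //=.
  2: by rewrite (setD1_imset_card _ (D_pure FD)) cR eqxx andbT.
have [RD|RD] := boolP (R \in D); last first.
  rewrite big1 // => F; rewrite inE => /and3P [FD _ RF].
  by case/negP: RD; apply: (D_complex.2 _ _ FD RF).
have := D_ridge RD (congr1 S cR); move/eqP/cards2P => [F [F' [FF' E]]].
have Ein G : G \in [set F; F'] -> G \in facets D /\ R \subset G.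
  by rewrite -E inE mem_facets => /and3P [-> -> ->].
have [FD RF] := Ein F (set21 _ _); have [FD' RF'] := Ein F' (set22 _ _).
rewrite E big_setU1 ?inE //= big_set1.
exact: cone_summand_opposite.
Qed.

End Cancellation.

(** * The generic parameters *)

(** Specializing the parameters of the [q]-th vertex of [t] to the [q]-th unit
vector turns the matrix into the identity. *)
Lemma param_mx_generic (k : fieldType) n N (t : n.-tuple 'I_N.+1) :
  uniq t -> simplex_det (param_mx k n N) t != 0.
Proof.
move=> ut.
pose A : 'M[{mpoly k[n * N.+1]}]_n := \matrix_(p, q) 'X_(mxvec_index p (tnth t q)).
have -> : simplex_det (param_mx k n N) t = tofrac (\det A).
  by rewrite -det_map_mx; congr (\det _); apply/matrixP => p q; rewrite !mxE.
rewrite tofrac_eq0; pose B : 'M[k]_(n, N.+1) := \matrix_(p, j) (tnth t p == j)%:R.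
apply/eqP => /(congr1 (meval (mxvec B 0))); rewrite meval0 -det_map_mx.
suff -> : map_mx (meval (mxvec B 0)) A = 1%:M.
  by rewrite det1 => /eqP; rewrite oner_eq0.
apply/matrixP => p q; rewrite !mxE /= mevalXU mxvecE mxE.
by rewrite (inj_eq (tuple_uniqP _ ut)).
Qed.

Lemma param_field_pchar2 (k : fieldType) n N :
  2%N \in [pchar k] -> 2%N \in [pchar (param_field k n N)].
Proof.
rewrite !inE /= => /eqP k2; apply/eqP.
have := rmorph_nat (@tofrac _ \o @mpolyC (n * N.+1) k) 2.
by rewrite k2 rmorph0 => <-.
Qed.

(** * The mixed volume as a sum over cones *)

Theorem theorem3p2 (R : realType) (k : fieldType) (n N : nat)
    (n_gt0 : (0 < n)%N)
    (D : {set {set 'I_N}}) (o : {set 'I_N} -> n.-tuple 'I_N)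
    (D_pseudo : pseudo_manifold R n D)
    (D_vertices : forall j : 'I_N, [set j] \in D)
    (D_oriented : oriented_over k D o)
    (oPi : {set 'I_N} -> {set 'I_N.+1} -> n.-tuple 'I_N.+1)
    (Pi_oriented : forall F, F \in facets D ->
       oriented_over k (cone_boundary F) (oPi F))
    (Pi_same : forall F, F \in facets D ->
       same_orientation (old_tuple (o F)) (oPi F (old_vertices F)))
    (f : {mpoly (param_field k n N)[N]}) (f_homog : f \is n.-homog) :
  mixed_volume (col' ord0 (param_mx k n N)) D o f
    = \sum_(F in facets D) mixed_volume_cone (param_mx k n N) F (oPi F) f
  /\
  \sum_(F in facets D) mixed_volume_cone (param_mx k n N) F (oPi F) f
    = \sum_(F in facets D)
        (cone_const (param_mx k n N) (o F))^-1
          * cone_ev (param_mx k n N) (o F) f.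
Proof.
case: n => [//|n] in n_gt0 o D_pseudo D_oriented oPi Pi_oriented Pi_same f f_homog *.
have pchar2 := @param_field_pchar2 k n.+1 N.
have generic := @param_mx_generic k n.+1 N.
case: D_pseudo => D_complex D_pure D_ridge _.
have cone_sum F : F \in facets D -> _ := fun FD =>
  cone_mixed_volume_sum pchar2 generic (D_oriented.1 F FD) (Pi_oriented F FD)
    (Pi_same F FD) f_homog.
have cone_value F : F \in facets D ->
    mixed_volume_cone (param_mx k n.+1 N) F (oPi F) f
    = (cone_const (param_mx k n.+1 N) (o F))^-1 * cone_ev (param_mx k n.+1 N) (o F) f.
  by move=> FD; apply: mixed_volumeP; apply: cone_sum.
split; last exact: eq_bigr.
apply: mixed_volumeP; rewrite -(sum_cone_boundaries pchar2 generic D_complex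
  D_pure D_ridge D_oriented Pi_oriented Pi_same) (eq_bigr _ cone_sum).
by rewrite (eq_bigr _ cone_value) -rmorph_sum.
Qed.
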